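(* For every integer $d\ge 21$, $$a(d)\ \ge\ \left\lceil \frac{928503}{2621440}\,2^d+\frac{683}{5}\right\rceil\ \ge\ \frac{17}{48}\,2^d .$$
   Context: The hypercube $Q_d$ is the graph whose vertices are the $2^d$ binary strings of length $d$, two vertices being adjacent if and only if they differ in exactly one coordinate. A snake in $Q_d$ is an induced path: a set of vertices which can be ordered without repetition so that consecutive vertices are adjacent in $Q_d$ and no other pair of them is adjacent in $Q_d$. The length of a snake is its number of edges (a snake of length $L$ has $L+1$ vertices). $a(d)$ denotes the greatest possible length of a snake in $Q_d$. *)

(* Defs.v *)
From mathcomp Require Import all_boot all_order all_algebra.
Set Implicit Arguments.
Unset Strict Implicit.
Unset Printing Implicit Defensive.

Definition vertex (d : nat) := d.-tuple bool.

Definition adj (d : nat) : rel (vertex d) :=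
  fun x y => #|[set i : 'I_d | tnth x i != tnth y i]| == 1.

Definition induced_path (d n : nat) (s : n.-tuple (vertex d)) : bool :=
  uniq s &&
  [forall i : 'I_n, forall j : 'I_n,
     adj (tnth s i) (tnth s j) == ((j == i.+1 :> nat) || (i == j.+1 :> nat))].

(* The empty set is excluded: a path has at least one vertex. *)
Definition snake (d : nat) (S : {set vertex d}) : bool :=
  (S != set0) &&
  [exists s : #|S|.-tuple (vertex d), (S == [set x in s]) && induced_path s].

(* A path on #|S| vertices has #|S| - 1 edges. *)
Definition snake_length (d : nat) (S : {set vertex d}) : nat := #|S|.-1.

Definition max_snake_length (d : nat) : nat :=
  \max_(S : {set vertex d} | snake S) snake_length S.

(* Main.v *)
(** The path runs through the layers [Q_8 x {u}] of [Q_8 x Q_k] following the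
    reflected Gray code in [u]. In [Q_8] there is a coil of length 96 disjoint from
    its image under an involution [sigma]; an even layer carries a path close to the
    coil and an odd layer the image under [sigma] of such a path. Consecutive layers
    share the vertex of [Q_8] at which the path changes layers; any other two layers
    at distance 1 must carry disjoint paths. These conditions depend only on the types
    of the layers: the position [l] of the first [true] in [u] and the parity of what
    follows the next coordinate if [l < 4], and otherwise one of six colours, such that
    adjacent layers of the same colour are consecutive. Fourteen paths in [Q_8],
    verified by computation, thus suffice for all [k]; weighted by the frequencies of
    their types they fill more than 90.73 of the 256 vertices of a layer on average,
    which is more than [256 * 928503 / 2621440]. *)

Require Import Defs.
From mathcomp Require Import all_boot all_order all_algebra.
From mathcomp Require Import zify lra.
Set Implicit Arguments.
Unset Strict Implicit.
Unset Printing Implicit Defensive.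

(** * Induced paths of bit sequences *)

Fixpoint diff (x y : bitseq) : nat :=
  match x, y with
  | a :: x', b :: y' => (a != b) + diff x' y'
  | _, _ => 0
  end.

Lemma diffC x y : diff x y = diff y x.
Proof. by elim: x y => [|a x IHx] [|b y] //=; rewrite IHx eq_sym. Qed.

Lemma diffxx x : diff x x = 0.
Proof. by elim: x => //= a x ->; rewrite eqxx. Qed.

Lemma diff_eq0 x y : size x = size y -> (diff x y == 0) = (x == y).
Proof.
elim: x y => [|a x IHx] [|b y] //= [eq_sz].
by rewrite addn_eq0 IHx // eqseq_cons; case: (a == b).
Qed.

Lemma diff_cat x y u v :
  size x = size y -> diff (x ++ u) (y ++ v) = diff x y + diff u v.
Proof. by elim: x y => [|a x IHx] [|b y] //= [eq_sz]; rewrite IHx ?addnA. Qed.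

Lemma diff_cons1 a b x y : size x = size y -> diff (a :: x) (b :: y) = 1 ->
  a = b /\ diff x y = 1 \/ b = ~~ a /\ y = x.
Proof.
move=> sz_xy /=; case: (eqVneq a b) => [->|ab]; first by left.
case=> /eqP; rewrite diff_eq0 // => /eqP->; right; split=> //.
by case: a b ab => -[].
Qed.

(** One recursion serves the induced paths and, with [next] and [apart], the Gray code. The relation
    [far] is only required from an earlier to a later element. *)
Fixpoint chain (T : eqType) (link far : T -> T -> Prop) (s : seq T) : Prop :=
  match s with
  | [::] => True
  | x :: s' =>
    match s' with
    | [::] => True
    | y :: s'' => link x y /\ {in s'', forall z, far x z}
    end /\ chain link far s'
  end.

Definition ipath : seq bitseq -> Prop :=
  chain (fun x y => diff x y = 1) (fun x y => 1 < diff x y).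

Lemma chain_cat (T : eqType) (link far : T -> T -> Prop) (s : seq T) (a b : T) (t : seq T) :
  chain link far (rcons s a) -> chain link far (b :: t) -> link a b ->
  {in s & b :: t, forall x y, far x y} -> {in t, forall y, far a y} ->
  chain link far (rcons s a ++ b :: t).
Proof.
move=> + bt_chain ab + at_far; elim: s => [|x s IHs] //= [xs s_chain] s_far.
split; last by apply: IHs => // y z ys zt; apply: s_far; rewrite // inE ys orbT.
case: s xs {IHs s_chain} s_far => [|y s] /= [xy x_far] s_far; split=> //.
  by move=> z zt; apply: s_far; rewrite inE ?eqxx ?zt ?orbT.
move=> z; rewrite mem_cat => /orP[zs|zt]; first exact: x_far.
by apply: s_far; rewrite // inE eqxx.
Qed.

Fixpoint parity (u : bitseq) : bool :=
  if u is a :: u' then a (+) parity u' else false.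

Lemma parity_diff u v : size u = size v -> odd (diff u v) = parity u (+) parity v.
Proof.
elim: u v => [|a u IHu] [|b v] //= [/IHu uv]; rewrite oddD uv.
by case: a; case: b; case: (parity u); case: (parity v).
Qed.

(** * The reflected Gray code *)

(* [link true] flips the leading coordinate of a layer and [link false] flips
   the coordinate following the first [true]: these are the two kinds of steps
   of the reflected Gray code. *)
Fixpoint link (t : bool) (u : bitseq) : bitseq :=
  match u with
  | [::] => [::]
  | a :: u' => if t then ~~ a :: u' else a :: link a u'
  end.

Lemma size_link t u : size (link t u) = size u.
Proof. by elim: u t => [|a u IHu] [] //=; rewrite IHu. Qed.

Lemma linkK t : involutive (link t).
Proof. by move=> u; elim: u t => [|a u IHu] [] //=; rewrite ?negbK ?IHu. Qed.

Lemma diff_link t u : link t u <> u -> diff u (link t u) = 1.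
Proof.
elim: u t => [|a u IHu] [] //=; first by rewrite diffxx; case: a.
by rewrite eqxx /= add0n => neq; apply: IHu => eq_u; rewrite eq_u in neq.
Qed.

Lemma parity_link t u : link t u <> u -> parity (link t u) = ~~ parity u.
Proof.
move=> /diff_link uv; have := parity_diff (esym (size_link t u)); rewrite uv /=.
by case: (parity u); case: (parity _).
Qed.

Fixpoint spread (a : bool) (s : seq bitseq) : seq bitseq :=
  if s is u :: s' then (a :: u) :: (~~ a :: u) :: spread (~~ a) s' else [::].

Fixpoint gray (k : nat) : seq bitseq :=
  if k is k'.+1 then spread false (gray k') else [:: [::]].

Lemma mem_spreadE a s x : x \in spread a s -> exists b u, x = b :: u /\ u \in s.
Proof.
elim: s a => [|u s IHs] a //=; rewrite !inE.
case/or3P=> [/eqP->|/eqP->|/IHs[b [v [-> vs]]]]; last by exists b, v; rewrite inE vs orbT.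
  by exists a, u; rewrite inE eqxx.
by exists (~~ a), u; rewrite inE eqxx.
Qed.

Lemma size_gray k : size (gray k) = 2 ^ k.
Proof.
elim: k => //= k IHk; rewrite expnS -IHk mul2n.
by elim: (gray k) (false) => //= u s IHs a; rewrite IHs.
Qed.

Lemma gray_size k : {in gray k, forall u, size u = k}.
Proof.
elim: k => [|k IHk] u /=; first by rewrite inE => /eqP->.
by case/mem_spreadE => a [v [-> /IHk <-]].
Qed.

Definition next (u v : bitseq) : Prop :=
  [/\ v = link (~~ parity u) u, v <> u & size v = size u].

(** No step of the code joins the two words in either direction, each [link t] being an involution.
    They may still differ in a single coordinate, and then their layers must carry disjoint
    paths. *)
Definition apart (u v : bitseq) : Prop :=
  [/\ v <> u, forall t, v <> link t u & size v = size u].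

Lemma chain_next_apart u s :
  chain next apart (u :: s) -> {in s, forall v, v <> u /\ size v = size u}.
Proof.
case: s => [|v s] //= [[[_ vu sz_v] us] _] w; rewrite inE => /orP[/eqP-> //|/us].
by case.
Qed.

Lemma next_head a u : parity u = a -> next (a :: u) (~~ a :: u).
Proof. by move=> <-; split=> //=; [rewrite addbb | case; case: (parity u)]. Qed.

(** Since [link false (a :: u) = a :: link a u], the last hypothesis keeps the would-be predecessor
    of the first word out of the rest of the list. *)
Lemma spread_chain a u s :
  parity u = a -> chain next apart (u :: s) -> link a u \notin s ->
  chain next apart (spread a (u :: s)).
Proof.
elim: s a u => [|v s IHs] a u pu.
  by move=> _ _; do 2!split => //; apply: next_head.
move=> uvs link_u; have us := chain_next_apart uvs.
case: uvs => [[[v_link vu sz_v] _] vs].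
have v_s := chain_next_apart vs.
rewrite pu in v_link; have pv : parity v = ~~ a.
  by rewrite v_link parity_link ?pu // -v_link.
have v_fresh : link (~~ a) v \notin s.
  rewrite v_link linkK; apply/negP => u_s.
  by have [] := us u (mem_behead (s := v :: s) u_s).
have {}IHs := IHs _ _ pv vs v_fresh.
have -> : spread a [:: u, v & s] = [:: a :: u, ~~ a :: u & spread (~~ a) (v :: s)] by [].
split; first split; first exact: next_head.
  move=> x /mem_spreadE[b [w [-> ws]]]; have [wu sz_w] := us w ws.
  split=> [[_ /wu //]|[] /= [_ w_eq]|/=]; [exact: wu| |by rewrite sz_w].
  by rewrite -w_eq ws in link_u.
split; last exact: IHs.
have nega : ~~ a <> a by case: (a).
split.
  split=> /=; [|by case=> /vu|by rewrite sz_v].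
  by rewrite pu -v_link; case: (a).
move=> x; rewrite inE => /predU1P[->|/mem_spreadE[b [w [-> ws]]]].
  split=> [[_ /vu //]|[] /= []|/=]; [by move=> /vu|move=> eq_a _|by rewrite sz_v].
  by move: eq_a; case: (a).
have [wu sz_w] := us w (mem_behead (s := v :: s) ws).
split=> [[_ /wu //]|[] /= [_]|/=]; [exact: wu| |by rewrite sz_w].
by rewrite -v_link => wv; case: (v_s w ws).
Qed.

Lemma gray_chain k : chain next apart (gray k).
Proof.
suff [s [eq_s s_chain s0]] : exists s, [/\ gray k = nseq k false :: s,
    chain next apart (nseq k false :: s) & parity (nseq k false) = false].
  by rewrite eq_s.
elim: k => [|k [s [/= -> s_chain s0]]]; first by exists [::].
eexists; split=> //; apply: spread_chain => //.
(* The code starts at the zero word, which [link false] fixes; freshness thus only says that this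
   word does not recur. *)
suff -> : link false (nseq k false) = nseq k false.
  by apply/negP => /(chain_next_apart s_chain)[].
by elim: k {s s_chain s0} => //= k ->.
Qed.

(** * Six colours for the deep layers *)

Definition palette (p : bool) : seq nat := if p then [:: 3; 4; 5] else [:: 0; 1; 2].

(** A palette has three colours and at most two are excluded, so the default 0 is never reached. *)
Definition pick_colour (p : bool) (c d : nat) : nat :=
  head 0 [seq e <- palette p | (e != c) && (e != d)].

Lemma pick_colourP p c d :
  [/\ pick_colour p c d \in palette p, pick_colour p c d != c
    & pick_colour p c d != d].
Proof.
have : [seq e <- palette p | (e != c) && (e != d)] != [::].
  by rewrite -has_filter; case: p; case: c => [|[|[|[|[|[|c]]]]]];
    case: d => [|[|[|[|[|[|d]]]]]].
rewrite /pick_colour; case E : (filter _ _) => [//|e s] _ /=.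
have : e \in [seq e <- palette p | (e != c) && (e != d)] by rewrite E inE eqxx.
by rewrite mem_filter => /andP[/andP[-> ->] ->].
Qed.

(* [colours u] is the pair of the colours of [u] and of [true :: u]. *)
Fixpoint colours (u : bitseq) : nat * nat :=
  if u is a :: u' then
    let (c, d) := colours u' in (if a then d else c, pick_colour (parity u') c d)
  else (0, 3).

Definition outer_colour (u : bitseq) : nat := (colours u).1.

Lemma outer_colour_cons a u :
  outer_colour (a :: u) = if a then (colours u).2 else outer_colour u.
Proof. by rewrite /outer_colour /=; case: (colours u); case: a. Qed.

Lemma colours2_palette a u : (colours (a :: u)).2 \in palette (parity u).
Proof. by rewrite /=; case: (colours u) => c d; case: (pick_colourP (parity u) c d). Qed.

Lemma colours_neq u : (colours u).1 != (colours u).2.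
Proof.
case: u => [|a u] //=; case: (colours u) => c d /=.
by case: (pick_colourP (parity u) c d) => _ pc pd; rewrite eq_sym; case: a.
Qed.

Lemma outer_colour_link u : outer_colour (link false u) = outer_colour u.
Proof.
elim: u => [|[] u IHu] //=; rewrite !outer_colour_cons //.
by case: u {IHu} => [|a u] //=; case: (colours u).
Qed.

Lemma palette_disj p c : c \in palette p -> c \in palette (~~ p) -> False.
Proof. by rewrite /palette; case: p; rewrite /= !inE => /or3P[] /eqP->. Qed.

(** A flip of the leading coordinate changes the colour by the choice of [pick_colour]. After a
    leading [true], a flip beyond the next coordinate changes the palette; after a leading [false],
    the colour is that of the tail. *)
Lemma outer_colour_neq u v :
  size u = size v -> diff u v = 1 -> v <> link false u ->
  outer_colour u <> outer_colour v.
Proof.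
elim: u v => [|a u IHu] [|b v] // [sz_uv].
move=> /(diff_cons1 sz_uv)[[<- uv]|[-> ->]] v_link; rewrite !outer_colour_cons; last first.
  by have /eqP := colours_neq u; rewrite /outer_colour; case: (a) => /= neq eq_c;
    apply: neq.
case: a v_link => /= v_link; last by apply: IHu => // eq_v; rewrite eq_v in v_link.
case: u v sz_uv {IHu} uv v_link => [|a u] [|{}b v] // [sz_uv].
move=> /(diff_cons1 sz_uv)[[<- uv _]|[-> -> []] //] eq_c.
have := colours2_palette a u; have := colours2_palette a v; rewrite eq_c.
have := parity_diff sz_uv; rewrite uv; case: (parity u); case: (parity v) => // _.
  by move=> p q; apply: palette_disj q p.
by move=> p q; apply: palette_disj q p.
Qed.

(** * Concatenation of induced paths *)

Definition separated (s t : seq bitseq) : Prop :=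
  {in s & t, forall x y, 1 < diff x y}.

Definition joined (s t : seq bitseq) : Prop :=
  exists s' a b t', [/\ s = rcons s' a, t = b :: t', diff a b = 1,
    separated s' t & separated [:: a] t'].

Lemma flatten_ipath (seg : bitseq -> seq bitseq) (near far : bitseq -> bitseq -> Prop) L :
  chain near far L -> {in L, forall u, ipath (seg u)} ->
  {in L &, forall u v, near u v -> joined (seg u) (seg v)} ->
  {in L &, forall u v, far u v -> separated (seg u) (seg v)} ->
  ipath (flatten [seq seg u | u <- L]).
Proof.
elim: L => [|u L IHL] //= [u_L L_chain] seg_ipath seg_joined seg_sep.
have {}IHL : ipath (flatten [seq seg v | v <- L]).
  by apply: IHL => // [v vL|v w vL wL|v w vL wL];
    [apply: seg_ipath|apply: seg_joined|apply: seg_sep]; rewrite inE ?vL ?wL orbT.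
have := seg_ipath u (mem_head _ _).
case: L u_L L_chain IHL seg_ipath seg_joined seg_sep => [|v L] /=.
  by rewrite cats0.
move=> [uv u_far] _ L_ipath _ seg_joined seg_sep u_ipath.
have uin : u \in [:: u, v & L] by rewrite inE eqxx.
have vin : v \in [:: u, v & L] by rewrite !inE eqxx orbT.
have Lfar x : x \in seg u -> {in flatten [seq seg w | w <- L], forall y, 1 < diff x y}.
  move=> x_u y /flatten_mapP[w wL y_w].
  by apply: (seg_sep u w) => //; [rewrite !inE wL !orbT|apply: u_far].
have [s [a [b [t [eq_u eq_v ab s_far a_far]]]]] := seg_joined u v uin vin uv.
rewrite eq_u in u_ipath Lfar *; rewrite eq_v in L_ipath s_far *.
apply: chain_cat => //.
  move=> x y xs; rewrite -cat_cons mem_cat => /orP[]; first exact: s_far.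
  by apply: Lfar; rewrite mem_rcons inE xs orbT.
move=> y; rewrite mem_cat => /orP[]; first by apply: a_far; rewrite inE.
by apply: Lfar; rewrite mem_rcons inE eqxx.
Qed.

Lemma ipath_uniq s : ipath s -> uniq s.
Proof.
elim: s => //= x s IHs [x_s /IHs->]; rewrite andbT.
case: s x_s {IHs} => //= y s [xy x_far]; rewrite inE negb_or.
apply/andP; split; first by apply/eqP => eq_xy; rewrite eq_xy diffxx in xy.
by apply/negP => /x_far; rewrite diffxx.
Qed.

Lemma ipath_map_cat b u s :
  {in s, forall x, size x = b} -> ipath s -> ipath [seq x ++ u | x <- s].
Proof.
elim: s => //= x s IHs sz [x_s s_ipath].
split; last by apply: IHs => // y ys; apply: sz; rewrite inE ys orbT.
have sz_x : size x = b by apply: sz; rewrite inE eqxx.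
case: s x_s sz {IHs s_ipath} => //= y s [xy x_far] sz.
split; first by rewrite diff_cat ?diffxx ?addn0 // sz_x sz // !inE eqxx orbT.
move=> _ /mapP[z zs ->]; rewrite diff_cat ?diffxx ?addn0; first exact: x_far.
by rewrite sz_x sz // !inE zs !orbT.
Qed.

(** * Types of layers and types of adjacent layers *)

(* A layer at level [l], that is [u = false^l ++ true :: b :: z], has type
   [2 l + parity z]; the types of the levels [n] and above are the colours of
   the remaining suffix. *)
Fixpoint mtype (n : nat) (u : bitseq) : nat :=
  match n, u with
  | n'.+1, false :: u' => (mtype n' u').+2
  | n'.+1, true :: u' => parity (behead u')
  | n'.+1, [::] => 0
  | 0, _ => outer_colour u
  end.

Lemma mtype_link n u : n < size u -> mtype n (link false u) = mtype n u.
Proof.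
elim: n u => [|n IHn] [|[] u] //=; try by rewrite ?outer_colour_link.
- by move=> _; exact: (outer_colour_link (true :: u)).
- by move=> _; exact: (outer_colour_link (false :: u)).
- by case: u.
by move/IHn->.
Qed.

(* The pairs of types of an even layer and of an odd layer that differ only in
   their first coordinate, which is [true] for the even layer in [down] and for
   the odd layer in [up]; the type of the other layer is shifted by 2. *)
Definition down (n s t : nat) : bool :=
  (s < 2) && if n is 0 then true else (s == 0) == (t < 2).

Definition up (n s t : nat) : bool :=
  (t < 2) && if n is 0 then true else (t == 1) == (s < 2).

(** A condition on the types [s] of an even and [t] of an odd layer at distance 1 that are not
    joined by [link false]. Two shifted types mean two leading [false]; exactly one shifted type
    means that the leading coordinate is flipped. *)
Fixpoint clash (n s t : nat) : bool :=
  if n is n'.+1 then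
    match s, t with
    | s'.+2, t'.+2 => clash n' s' t'
    | s'.+2, _ => up n' s' t
    | _, t'.+2 => down n' s t'
    | _, _ => s != t
    end
  else s != t.

Lemma mtype_flip n a u : n < size u -> parity (a :: u) = false ->
  if a then down n (mtype n.+1 (true :: u)) (mtype n u)
  else up n (mtype n u) (mtype n.+1 (true :: u)).
Proof.
case: u => // b z; rewrite ltnS /= => nz.
case: n nz => [|n] nz; case: a; case: b => //=; case: (parity z) => //= _;
  by rewrite /down /up /=; case: (parity (behead z)).
Qed.

Lemma mtypeP n u v : n < size u -> size u = size v -> parity u = false ->
  diff u v = 1 -> v <> link false u -> clash n (mtype n u) (mtype n v).
Proof.
elim: n u v => [|n IHn] [|a u] [|c v] // nu sz_uv pu uv v_link.
  by apply/eqP; apply: outer_colour_neq.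
case: sz_uv => sz_uv; have {}nu : n < size u by [].
have := mtype_flip (a := a) nu pu; move: v_link.
case: (diff_cons1 sz_uv uv) => [[<- {}uv] v_link|[-> ->] _]; last first.
  by case: (a) => /=; case: (parity (behead u)) => h; exact: h.
case: a pu uv v_link => pu uv v_link _ /=; last first.
  by apply: IHn => // eq_v; apply: v_link; rewrite eq_v.
(* Both layers are at level 0, and the flip is not in the coordinate after the [true], so it changes
   the parity of the rest. *)
case: u v sz_uv {IHn nu} pu uv v_link => [|a u] [|b v] // [sz_uv] pu.
case/(diff_cons1 sz_uv) => [[<- uv _]|[-> -> []] //] /=.
have := parity_diff sz_uv; rewrite uv.
by case: (parity u); case: (parity v).
Qed.

Lemma clashxx n s : clash n s s = false.
Proof. by elim: n s => [|n IHn] [|[|s]] //=; rewrite eqxx. Qed.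

(** * Gluing the layers *)

Section Family.

(** The path of a layer of parity [p] and type [s] is [piece p s]. It changes layers at [X p s] when
    the leading coordinate flips, and at [Y s] along [link false]; the latter keeps the type, so [Y]
    need not depend on the parity. There are [l + 1] levels of two types each, and six colours. *)
Variables (b l : nat) (X : bool -> nat -> bitseq) (Y : nat -> bitseq).
Variable piece : bool -> nat -> seq bitseq.

Local Notation valid s := (s < l.*2 + 8).
Local Notation type u := (mtype l.+1 u).

(** Of two layers differing in the leading coordinate exactly one is at level 0, that is, has a type
    below 2. *)
Definition joint (s t : nat) : bool :=
  match s, t with
  | s'.+2, t'.+2 => false
  | s'.+2, _ => up l s' t
  | _, t'.+2 => down l s t'
  | _, _ => false
  end.

Hypothesis piece_size : forall p s, valid s -> {in piece p s, forall x, size x = b}.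
Hypothesis piece_ipath : forall p s, valid s -> ipath (piece p s).
(** Even layers are left, and odd layers entered, by flipping the leading coordinate; hence the two
    orientations. *)
Hypothesis piece_ends : forall p s, valid s -> exists r,
  piece p s = if p then X p s :: rcons r (Y s) else Y s :: rcons r (X p s).
Hypothesis joint_ends : forall s t, valid s -> valid t -> joint s t ->
  X false s = X true t.
Hypothesis piece_meet : forall s t x, valid s -> valid t ->
  x \in piece false s -> x \in piece true t ->
  if s == t then x = Y s else if joint s t then x = X false s else ~~ clash l.+1 s t.

Definition layer (u : bitseq) : seq bitseq :=
  [seq x ++ u | x <- piece (parity u) (type u)].

Definition family_path (k : nat) : seq bitseq := flatten [seq layer u | u <- gray k].

Lemma colours_lt6 u : ((colours u).1 < 6) && ((colours u).2 < 6).
Proof.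
elim: u => //= a u; case: (colours u) => c d /= /andP[c6 d6].
have -> : (if a then d else c) < 6 by case: (a).
by case: (pick_colourP (parity u) c d) => + _ _; case: (parity u);
  rewrite /= !inE => /or3P[] /eqP->.
Qed.

Lemma type_valid u : valid (type u).
Proof.
suff gen n v : mtype n v < n.*2 + 6 by have := gen l.+1 u; rewrite doubleS !addSn !addnS.
elim: n v => [|n IHn] v; first by case/andP: (colours_lt6 v).
rewrite doubleS !addSn; case: v => [|[] v] //=; first by case: (parity _).
by rewrite !ltnS IHn.
Qed.

Lemma flip_joint u : l.+1 < size u -> parity u = false ->
  joint (type u) (type (link true u)).
Proof.
case: u => // a u lu pu; have := @mtype_flip l a u lu pu.
by case: a {lu pu} => /=; case: (parity (behead u)) => h; exact: h.
Qed.

Lemma layers_meet u v x : l.+1 < size u -> size v = size u -> parity u = false ->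
  diff u v = 1 -> x \in piece false (type u) -> x \in piece true (type v) ->
  v = link true u /\ x = X false (type u) \/ v = link false u /\ x = Y (type u).
Proof.
move=> lu sz_v pu uv xu xv; have := piece_meet (type_valid u) (type_valid v) xu xv.
have [eq_v|nlink] := eqVneq v (link false u).
  by rewrite eq_v mtype_link // eqxx => ->; right.
have uv_clash := mtypeP lu (esym sz_v) pu uv (elimN eqP nlink).
have /negbTE-> : type u != type v by apply/eqP => eq_t; rewrite eq_t clashxx in uv_clash.
have [eq_v|ntrue] := eqVneq v (link true u).
  by rewrite eq_v flip_joint // => ->; left.
(* The leading coordinates now agree, so both types are below 2 or neither is. *)
suff -> : joint (type u) (type v) = false by rewrite uv_clash.
move: uv_clash ntrue nlink; case: u v sz_v pu uv lu {xu xv} => [|a u] [|c v] // [sz_v] pu.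
case/(diff_cons1 (esym sz_v)) => [[<- uv]|[-> ->]]; last by rewrite eqxx.
case: a pu => //= _ _ _ _ _; case: (parity (behead u)); by case: (parity (behead v)).
Qed.

(** Distinct vertices of the two paths already differ in the first [b] coordinates, and the layers
    add one more difference; only the copies of [a] are adjacent. *)
Lemma joined_layers s t a u v : size u = size v -> diff u v = 1 ->
  {in rcons s a, forall x, size x = b} -> {in a :: t, forall x, size x = b} ->
  uniq (rcons s a) -> uniq (a :: t) -> {in rcons s a, forall x, x \in a :: t -> x = a} ->
  joined [seq x ++ u | x <- rcons s a] [seq x ++ v | x <- a :: t].
Proof.
move=> sz_uv uv sz_s sz_t; rewrite rcons_uniq => /andP[a_s _] /= /andP[a_t _] st.
exists [seq x ++ u | x <- s], (a ++ u), (a ++ v), [seq x ++ v | x <- t].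
have far x y : x \in rcons s a -> y \in a :: t -> x != y -> 1 < diff (x ++ u) (y ++ v).
  move=> xs yt xy; have sz_xy : size x = size y by rewrite sz_s ?sz_t.
  rewrite diff_cat // uv addn1 ltnS lt0n diff_eq0 //.
split=> //.
- by rewrite map_rcons.
- by rewrite diff_cat // diffxx uv.
- move=> _ y /mapP[x xs ->] yt; have {yt} /mapP[z zt ->] : y \in [seq x ++ v | x <- a :: t].
    by [].
  have x_s : x \in rcons s a by rewrite mem_rcons inE xs orbT.
  apply: far => //; apply/eqP => eq_xz; rewrite -eq_xz in zt.
  by rewrite -(st x x_s zt) xs in a_s.
move=> x y; rewrite inE => /eqP-> /mapP[z zt ->]; apply: far.
- by rewrite mem_rcons inE eqxx.
- by rewrite inE zt orbT.
by apply/eqP => eq_az; rewrite eq_az zt in a_t.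
Qed.

Lemma layer_ipath u : ipath (layer u).
Proof.
by apply: (@ipath_map_cat b); [apply: piece_size|apply: piece_ipath]; exact: type_valid.
Qed.

Lemma link_neq u : u != [::] -> link true u <> link false u.
Proof. by case: u => // a u _ []; case: (a). Qed.

Local Arguments mtype : simpl never.

Lemma layers_joined u v : l.+1 < size u -> next u v -> joined (layer u) (layer v).
Proof.
move=> lu [v_link vu sz_v]; have tu := type_valid u; have tv := type_valid v.
have uv : diff u v = 1 by rewrite v_link diff_link // -v_link.
have pv : parity v = ~~ parity u by rewrite {1}v_link parity_link // -v_link.
have u0 : u != [::] by apply/eqP => eq_u; rewrite eq_u in lu.
have szu := piece_size (p := parity u) tu; have szv := piece_size (p := parity v) tv.
have uu := ipath_uniq (piece_ipath (parity u) tu).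
have uv' := ipath_uniq (piece_ipath (parity v) tv).
rewrite /layer; have [s] := piece_ends (parity u) tu; have [t] := piece_ends (parity v) tv.
rewrite pv in szv uv' *; case pu: (parity u) v_link szu szv uu uv' => /= v_link
  szu szv uu uv' et es.
  have eY : type v = type u by rewrite v_link mtype_link.
  have meet x : x \in piece true (type u) -> x \in piece false (type v) -> x = Y (type u).
    move=> xu xv; rewrite -eY.
    have [] := @layers_meet v u x; rewrite ?sz_v ?pv ?pu ?(diffC v) //.
      by rewrite v_link => -[] /esym; rewrite -{2}(linkK false u) => /link_neq; case;
        rewrite -size_eq0 size_link size_eq0.
    by case.
  rewrite -eY in es meet szu uu *; rewrite es in szu uu meet *; rewrite et in szv uv' meet *.
  exact: (@joined_layers (_ :: s) (rcons t _) (Y (type v))).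
have eX : X false (type u) = X true (type v).
  by apply: joint_ends => //; rewrite v_link flip_joint.
have meet x : x \in piece false (type u) -> x \in piece true (type v) -> x = X false (type u).
  move=> xu xv; have [] := @layers_meet u v x lu sz_v pu uv xu xv; first by case.
  by rewrite v_link => -[] /link_neq; case.
rewrite es in szu uu meet *; rewrite et -eX in szv uv' meet *.
exact: (@joined_layers (_ :: s) (rcons t _) (X false (type u))).
Qed.

Lemma layers_separated u v : l.+1 < size u -> apart u v -> separated (layer u) (layer v).
Proof.
move=> lu [vu nlink sz_v] _ _ /mapP[x xu ->] /mapP[y yv ->].
have sz_xy : size x = size y.
  by rewrite (piece_size (type_valid u) xu) (piece_size (type_valid v) yv).
rewrite diff_cat //; case: (ltngtP (diff u v) 1) => [|uv|uv].
- by rewrite ltnS leqn0 diff_eq0 // => /eqP/esym.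
- exact: leq_trans uv (leq_addl _ _).
rewrite uv addn1 ltnS lt0n diff_eq0 //; apply/eqP => eq_xy; rewrite -eq_xy in yv.
have pv : parity v = ~~ parity u.
  by have := parity_diff (esym sz_v); rewrite uv; case: (parity u); case: (parity v).
rewrite pv in yv; case pu: (parity u) xu yv => xu yv.
  have [] := @layers_meet v u x _ (esym sz_v) _ _ yv xu.
  - by rewrite sz_v.
  - by rewrite pv pu.
  - by rewrite diffC.
  - by case=> eq_u _; case: (nlink true); rewrite eq_u linkK.
  by case=> eq_u _; case: (nlink false); rewrite eq_u linkK.
by have [] := @layers_meet u v x lu sz_v pu uv xu yv; case=> /nlink.
Qed.

Lemma family_path_ipath k : l.+1 < k -> ipath (family_path k).
Proof.
move=> lk; apply: (flatten_ipath (gray_chain k)) => [u _|u v uk _|u v uk _].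
- exact: layer_ipath.
- by apply: layers_joined; rewrite (gray_size uk).
by apply: layers_separated; rewrite (gray_size uk).
Qed.

Lemma family_path_size k : {in family_path k, forall x, size x = b + k}.
Proof.
move=> _ /flatten_mapP[u uk /mapP[x xu ->]]; rewrite size_cat (gray_size uk).
by rewrite (piece_size (type_valid u) xu).
Qed.

End Family.

(** * From lists of bit sequences to snakes *)

Lemma ipath_nth s i j : ipath s -> i < j -> j < size s ->
  (diff (nth [::] s i) (nth [::] s j) == 1) = (j == i.+1).
Proof.
elim: s i j => [|x s IHs] [|i] [|j] //= [x_s s_ipath] ij js; last exact: IHs.
case: s x_s js {IHs s_ipath} => [//|y s] [xy x_far]; case: j ij => [|j] _ /= js.
  by rewrite xy eqxx.
by have := x_far _ (mem_nth [::] (n := j) js); case: ltngtP.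
Qed.

Lemma diff_sum d x y : size x = d -> size y = d ->
  diff x y = \sum_(i < d) (nth false x i != nth false y i).
Proof.
elim: d x y => [|d IHd] [|a x] [|b y] //=; first by rewrite big_ord0.
by move=> [sz_x] [sz_y]; rewrite big_ord_recl (IHd x y).
Qed.

Lemma adj_diff d (x y : vertex d) : adj x y = (diff x y == 1).
Proof.
rewrite /adj (@diff_sum d) ?size_tuple // -sum1_card big_mkcond /=.
congr (_ == 1); apply: eq_bigr => i _.
by rewrite inE !(tnth_nth false); case: (_ == _).
Qed.

Lemma ipath_max_snake_length d s : {in s, forall x, size x = d} -> ipath s ->
  (size s).-1 <= max_snake_length d.
Proof.
move=> sz s_ipath; case: (posnP (size s)) => [->//|s_gt0].
(* The default word only makes [vx] total; every element of [s] has length [d]. *)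
pose vx x : vertex d := insubd [tuple of nseq d false] x.
have val_vx x : x \in s -> vx x = x :> bitseq.
  by move=> /sz sz_x; rewrite val_insubd sz_x eqxx.
pose t := map vx s.
have t_uniq : uniq t.
  rewrite map_inj_in_uniq ?ipath_uniq // => x y xs ys eq_xy.
  by rewrite -(val_vx x xs) eq_xy val_vx.
pose S := [set x in t].
have card_S : #|S| = size s by rewrite cardsE (card_uniqP t_uniq) size_map.
rewrite -card_S -/(snake_length S); apply: leq_bigmax_cond; apply/andP; split.
  by rewrite -card_gt0 card_S.
have szt : size t == #|S| by rewrite size_map card_S.
apply/existsP; exists (Tuple szt); rewrite eqxx /=; apply/andP; split=> //.
apply/'forall_forallP => i j; rewrite adj_diff !(tnth_nth (vx [::])) /=.
have ltS (k : 'I_#|S|) : k < size s by rewrite -card_S.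
have nth_t (k : 'I_#|S|) : nth (vx [::]) t k = nth [::] s k :> bitseq.
  by rewrite (nth_map [::]) // val_vx // mem_nth.
rewrite !nth_t; apply/eqP; case: (ltngtP i j) => ij.
- by rewrite ipath_nth // (ltn_eqF (ltnW ij : i < j.+1)) orbF.
- by rewrite diffC ipath_nth // (ltn_eqF (ltnW ij : j < i.+1)).
by rewrite ij diffxx !ltn_eqF.
Qed.

(** * A checker for induced paths *)

(** Sets of words of equal length, in which the cost of looking for a word within distance 1 depends
    on the length of the words and not on their number. *)
Inductive trie := Empty | Leaf | Node of trie & trie.

Fixpoint trie_mem (x : bitseq) (t : trie) : bool :=
  match x, t with
  | [::], Leaf => true
  | a :: x', Node t0 t1 => trie_mem x' (if a then t1 else t0)
  | _, _ => false
  end.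

Fixpoint trie_near (x : bitseq) (t : trie) : bool :=
  match x, t with
  | [::], Leaf => true
  | a :: x', Node t0 t1 =>
    trie_mem x' (if a then t0 else t1) || trie_near x' (if a then t1 else t0)
  | _, _ => false
  end.

Fixpoint trie_add (x : bitseq) (t : trie) : trie :=
  if x is a :: x' then
    let (t0, t1) := if t is Node t0 t1 then (t0, t1) else (Empty, Empty) in
    if a then Node t0 (trie_add x' t1) else Node (trie_add x' t0) t1
  else Leaf.

Definition trie_of (s : seq bitseq) : trie := foldr trie_add Empty s.

Lemma trie_mem_add x t : trie_mem x (trie_add x t).
Proof. by elim: x t => [|[] x IHx] [||t0 t1] /=. Qed.

Lemma trie_mem_addW x y t : size x = size y ->
  trie_mem x t -> trie_mem x (trie_add y t).
Proof.
by elim: x y t => [|a x IHx] [|b y] //= [||t0 t1] //= [sz];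
  case: a; case: b => //=; apply: IHx.
Qed.

Lemma trie_near_add x y t : size x = size y -> diff x y <= 1 ->
  trie_near x (trie_add y t).
Proof.
elim: x y t => [|a x IHx] [|b y] //= t [sz].
case: (eqVneq a b) => [<-|ab]; last first.
  rewrite add1n ltnS leqn0 diff_eq0 // => /eqP<-.
  by case: t => [||t0 t1]; case: a b ab => -[] //= _; rewrite trie_mem_add.
by rewrite add0n => xy; case: t => [||t0 t1]; case: a => /=; rewrite IHx ?orbT.
Qed.

Lemma trie_near_addW x y t : size x = size y ->
  trie_near x t -> trie_near x (trie_add y t).
Proof.
elim: x y t => [|a x IHx] [|b y] //= [||t0 t1] //= [sz].
by case: a; case: b => /= /orP[xt|xt]; apply/orP;
  [left|right|left|right|left|right|left|right] => //; first [exact: IHx | exact: trie_mem_addW].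
Qed.

(** This direction suffices: a trie finding too much would only make the checks stricter. *)
Lemma trie_of_mem b s x : {in s, forall y, size y = b} -> x \in s -> trie_mem x (trie_of s).
Proof.
elim: s => //= y s IHs sz; rewrite inE => /predU1P[->|xs]; first exact: trie_mem_add.
have sub z : z \in s -> z \in y :: s by rewrite inE orbC => ->.
apply: trie_mem_addW; first by rewrite !sz ?inE ?eqxx ?xs ?orbT.
by apply: IHs => // z /sub/sz.
Qed.

Lemma trie_of_near b s x y : {in s, forall z, size z = b} -> size x = b -> y \in s ->
  diff x y <= 1 -> trie_near x (trie_of s).
Proof.
elim: s => //= z s IHs sz sz_x; have sz_xz : size x = size z by rewrite sz_x (sz z) // mem_head.
rewrite inE => /predU1P[->|ys] xy; first exact: trie_near_add.
by apply: trie_near_addW => //; apply: IHs => // t ts; apply: sz; rewrite inE ts orbT.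
Qed.

(** Here [x] is the current end of the path and [t] holds the vertices before it. *)
Fixpoint ipathb (x : bitseq) (t : trie) (s : seq bitseq) : bool :=
  if s is y :: s' then
    [&& size y == size x, diff x y == 1, ~~ trie_near y t & ipathb y (trie_add x t) s']
  else true.

Lemma ipathbP x s : ipathb x Empty s ->
  ipath (x :: s) /\ {in s, forall y, size y = size x}.
Proof.
(* The list [r] holds the vertices before [x], the latest first. *)
suff main r : {in r, forall y, size y = size x} -> ipath (rcons (rev r) x) ->
    ipathb x (trie_of r) s ->
    ipath (rcons (rev r) x ++ s) /\ {in s, forall y, size y = size x}.
  exact: (main [::]).
elim: s x r => [|y s IHs] x r sz_r r_ipath /=; first by rewrite cats0.
case/and4P=> /eqP sz_y /eqP xy y_far s_ipath.
have far : {in r, forall z, 1 < diff z y}.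
  move=> z zr; rewrite ltnNge diffC; apply: contra y_far => yz.
  exact: trie_of_near sz_r sz_y zr yz.
have [] := IHs y (x :: r) _ _ s_ipath.
- by move=> z; rewrite inE sz_y => /predU1P[->|/sz_r].
- rewrite rev_cons -[rcons _ y]cats1; apply: chain_cat => // z w.
  by rewrite mem_rev mem_seq1 => zr /eqP->; apply: far.
rewrite rev_cons cat_rcons => s_path sz_s; split=> // z.
by rewrite inE => /predU1P[->|/sz_s->].
Qed.

(** * Counting vertices *)

Lemma sum_gray (f : bitseq -> nat) k :
  \sum_(u <- gray k.+1) f u = \sum_(u <- gray k) (f (false :: u) + f (true :: u)).
Proof.
suff spreadE a s : \sum_(u <- spread a s) f u =
    \sum_(u <- s) (f (false :: u) + f (true :: u)) by exact: spreadE.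
elim: s a => [|u s IHs] a; first by rewrite !big_nil.
by rewrite !big_cons IHs !addnA; case: a; rewrite //= [f (true :: u) + _]addnC.
Qed.

Lemma sum_gray_const k c : \sum_(u <- gray k) c = c * 2 ^ k.
Proof. by rewrite big_const_seq count_predT iter_addn_0 size_gray. Qed.

(* The layers of a level come in pairs [true :: false :: z], [true :: true :: z]
   of opposite parities and of the same type. *)
Lemma sum_levels (len : bool -> nat -> nat) (w : nat -> nat) n c k :
  (forall i (a : bool), i < n ->
     w i <= len false (c + i.*2 + a) + len true (c + i.*2 + a)) ->
  \sum_(i < n) w i * 2 ^ (k + n - i.+1) +
    \sum_(u <- gray k.+1) len (parity u) (c + n.*2 + outer_colour u) <=
  \sum_(u <- gray (k + n).+1) len (parity u) (c + mtype n u).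
Proof.
elim: n c w => [|n IHn] c w w_lev.
  by rewrite big_ord0 add0n addn0; under eq_bigr do rewrite addn0.
rewrite addnS [leqRHS]sum_gray big_split /=.
have {}IHn : \sum_(i < n) w i.+1 * 2 ^ (k + n - i.+1) +
      \sum_(u <- gray k.+1) len (parity u) (c + n.+1.*2 + outer_colour u) <=
    \sum_(u <- gray (k + n).+1) len (parity u) (c + (mtype n u).+2).
  under [leqRHS]eq_bigr => u _ do rewrite -!addSnnS.
  have -> : c + n.+1.*2 = c.+2 + n.*2 by rewrite doubleS !addnS.
  apply: (IHn c.+2 (fun i => w i.+1)) => i a i_n.
  by have := w_lev i.+1 a i_n; rewrite doubleS -!addSnnS.
rewrite big_ord_recl -addnA [leqRHS]addnC; apply: leq_add; last first.
  by apply: leq_trans IHn; rewrite leq_add2r; apply: leq_sum => i _; rewrite subSS.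
rewrite subSS subn0 sum_gray -sum_gray_const leq_sum // => u _ /=.
by have := w_lev 0 (parity u) isT; rewrite addn0; case: (parity u) => /=; rewrite // addnC.
Qed.

(** The transfer operator of the colouring: parity and colour pair of a word determine those of its
    two extensions by a leading coordinate, over which [g] is summed. *)
Definition extend (g : bool -> nat -> nat -> nat) (p : bool) (c d : nat) : nat :=
  let e := pick_colour p c d in g p c e + g (~~ p) d e.

Lemma sum_colours (g : bool -> nat -> nat -> nat) k m :
  \sum_(u <- gray (k + m)) g (parity u) (colours u).1 (colours u).2 =
  \sum_(u <- gray k) iter m extend g (parity u) (colours u).1 (colours u).2.
Proof.
elim: m g => [|m IHm] g; first by rewrite addn0.
rewrite addnS sum_gray iterSr -IHm; apply: eq_bigr => u _ /=.
by case: (colours u).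
Qed.

Lemma sum_colours_ge g k m w :
  (forall p c d, c < 6 -> d < 6 -> w <= iter m extend g p c d) ->
  w * 2 ^ k <= \sum_(u <- gray (k + m)) g (parity u) (colours u).1 (colours u).2.
Proof.
move=> w_le; rewrite sum_colours -sum_gray_const leq_sum // => u _.
by case/andP: (colours_lt6 u) => c6 d6; apply: w_le.
Qed.

(** * The paths in the cube of dimension 8 *)

Definition sigma (x : bitseq) : bitseq :=
  if x is [:: a0; a1; a2; a3; a4; a5; a6; a7]
  then [:: ~~ a0; a1; a2; a3; a5; a4; a7; a6] else x.

Fixpoint flip (i : nat) (x : bitseq) : bitseq :=
  match x, i with
  | [::], _ => [::]
  | a :: x', 0 => ~~ a :: x'
  | a :: x', i'.+1 => a :: flip i' x'
  end.

(* Found by computer search: the first vertex of the path of each type and the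
   coordinates that it flips. Types 0 to 7 are those of the levels 0 to 3, two for
   each level, and types 8 to 13 are the six colours of the deeper levels. *)
Definition route_code (s : nat) : bitseq * seq nat :=
  nth ([::], [::]) [::
  ([:: false; false; false; false; true; true; true; true],
   [:: 4; 6; 0; 4; 7; 6; 2; 1; 4; 5; 0; 6; 4; 0; 7; 5; 4; 0; 6; 4; 5; 1; 3; 5; 4; 6;
       0; 4; 7; 5; 0; 4; 6; 0; 5; 2; 6; 0; 4; 6; 5; 0; 7; 6; 4; 0; 6; 1; 7; 6; 4; 0;
       5; 7; 0; 2; 5; 4; 0; 7; 5; 0; 6; 4; 5; 0; 7; 5; 4; 2; 3; 4; 5; 7; 0; 5; 6; 4;
       0; 5; 7; 0; 4; 1; 7; 4; 6; 0; 7; 2; 6; 7; 5; 0; 6]);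
  ([:: true; false; false; false; true; true; true; true],
   [:: 1; 5; 7; 0; 5; 6; 4; 0; 5; 7; 0; 4; 1; 7; 4; 6; 0; 7; 2; 6; 7; 5; 0; 4; 6; 0;
       1; 4; 5; 0; 6; 4; 0; 7; 5; 4; 0; 6; 1; 3; 6; 0; 4; 7; 5; 0; 4; 6; 0; 5; 2; 7;
       1; 2; 4; 5; 7; 0; 5; 4; 6; 0; 5; 7; 0; 4; 5; 2; 0; 7; 5; 0; 4; 6; 7; 1; 6; 0;
       4; 6; 7; 0; 5; 7]);
  ([:: true; true; true; false; false; false; true; true],
   [:: 7; 0; 6; 4; 0; 5; 7; 4; 0; 6; 4; 5; 1; 3; 5; 4; 6; 0; 4; 7; 5; 0; 4; 6; 0; 5;
       2; 6; 0; 4; 6; 5; 0; 7; 6; 4; 0; 6; 1; 7; 6; 4; 0; 5; 7; 0; 2; 5; 4; 0; 7; 5;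
       0; 6; 4; 5; 0; 7; 5; 4; 2; 3; 4; 5; 7; 0; 5; 6; 4; 0; 5; 7; 0; 4; 1; 7; 4; 6;
       5; 7; 6; 0; 4; 7; 6; 2; 0; 6; 4; 0; 5; 7; 4]);
  ([:: false; true; true; false; false; false; true; true],
   [:: 7; 6; 4; 0; 5; 6; 1; 0; 5; 7; 3; 5; 4; 6; 0; 4; 7; 5; 0; 4; 6; 0; 5; 2; 6; 0;
       4; 6; 5; 0; 7; 6; 4; 0; 6; 1; 7; 6; 4; 0; 5; 7; 0; 2; 5; 4; 0; 7; 5; 0; 6; 4;
       5; 0; 7; 5; 4; 2; 3; 4; 5; 7; 0; 5; 6; 4; 0; 5; 7; 0; 4; 1; 7; 0; 5; 7; 4; 0;
       6; 7; 5; 0; 7; 2; 6; 4]);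
  ([:: false; true; false; true; false; true; true; false],
   [:: 2; 4; 5; 0; 7; 5; 4; 2; 3; 4; 5; 7; 0; 5; 6; 4; 0; 5; 7; 0; 4; 1; 7; 0; 5; 7;
       4; 0; 6; 7; 5; 0; 7; 2; 6; 7; 5; 0; 4; 6; 0; 1; 4; 5; 0; 6; 4; 0; 7; 5; 4; 0;
       6; 4; 5; 1; 3; 5; 4; 6; 0; 4; 5; 7; 0; 4; 6; 0; 5; 2; 6; 5; 7; 0; 6; 1; 2; 6;
       0; 7; 5; 4; 2; 7; 0; 1; 7; 6; 5; 0; 7; 5]);
  ([:: true; true; false; true; true; false; false; true],
   [:: 7; 0; 4; 6; 7; 1; 6; 0; 7; 5; 6; 2; 5; 0; 6; 4; 0; 5; 7; 4; 0; 6; 4; 5; 3; 1;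
       5; 4; 6; 0; 4; 5; 7; 0; 4; 6; 0; 5; 4; 1; 0; 6; 4; 0; 5; 7; 6; 2; 7; 0; 5; 7;
       6; 0; 4; 7; 5; 0; 7; 1; 4; 0; 7; 5; 0; 4; 6; 5; 0; 7; 5; 4; 3; 2; 4; 5; 7; 0;
       5; 4; 6; 0; 5; 7; 0; 4; 5; 2; 1; 7; 6; 5; 0; 7; 5]);
  ([:: true; false; true; false; true; true; true; true],
   [:: 7; 4; 1; 5; 0; 6; 4; 0; 5; 7; 4; 0; 6; 4; 5; 1; 3; 5; 4; 6; 0; 4; 5; 7; 0; 4;
       6; 0; 7; 3; 2; 7; 0; 5; 7; 6; 0; 4; 7; 5; 0; 7; 1; 4; 0; 7; 5; 0; 4; 6; 5; 0;
       7; 5; 4; 3; 2; 4; 5; 7; 0; 5; 4; 6; 0; 5; 7; 0; 4; 5; 2; 0; 7; 5; 0; 4; 6; 7;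
       1; 6; 0; 7; 5; 0; 4; 6; 5; 0; 7; 5]);
  ([:: false; false; true; false; true; true; true; true],
   [:: 3; 4; 6; 0; 4; 7; 5; 0; 4; 6; 0; 5; 3; 1; 5; 0; 7; 5; 6; 0; 4; 5; 1; 4; 6; 2;
       7; 0; 5; 7; 6; 0; 4; 7; 5; 0; 7; 1; 4; 0; 7; 5; 0; 4; 6; 5; 0; 7; 5; 4; 3; 2;
       4; 5; 7; 0; 5; 4; 6; 0; 5; 7; 0; 4; 5; 2; 0; 7; 5; 0; 4; 6; 7; 1; 6; 0; 7; 5;
       0; 4; 6; 5; 0; 7; 5]);
  ([:: true; true; true; true; true; true; false; false],
   [:: 4; 0; 6; 4; 5; 0; 7; 5; 4; 2; 3; 4; 5; 7; 0; 5; 6; 4; 0; 5; 7; 0; 4; 1; 7; 0;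
       5; 7; 4; 0; 6; 7; 5; 0; 7; 2; 6; 7; 5; 0; 4; 6; 0; 1; 4; 5; 0; 6; 4; 0; 7; 5;
       4; 0; 6; 4; 5; 1; 3; 5; 4; 6; 0; 4; 5; 7; 0; 4; 6; 0; 5; 2; 6; 5; 7; 0; 6; 1;
       7; 6; 4; 0; 7; 5; 0; 1; 7; 6; 5; 0; 7; 5]);
  ([:: false; true; true; true; false; false; true; true],
   [:: 6; 0; 7; 5; 0; 6; 4; 5; 0; 7; 5; 4; 2; 3; 4; 5; 7; 0; 5; 6; 4; 0; 5; 7; 0; 4;
       1; 7; 0; 5; 7; 4; 0; 6; 7; 5; 0; 7; 2; 6; 7; 5; 0; 4; 6; 0; 1; 4; 5; 0; 6; 4;
       0; 7; 5; 4; 0; 6; 4; 5; 1; 3; 5; 4; 6; 0; 4; 7; 5; 0; 4; 6; 0; 5; 2; 6; 0; 4;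
       7; 1; 0; 5; 1; 6; 5]);
  ([:: false; false; false; false; true; true; false; true],
   [:: 0; 7; 5; 0; 4; 6; 5; 1; 6; 0; 5; 7; 0; 6; 3; 7; 6; 4; 0; 7; 5; 0; 2; 5; 4; 0;
       7; 5; 0; 6; 4; 5; 0; 7; 5; 4; 2; 3; 1; 5; 2; 6; 7; 5; 0; 4; 6; 0; 1; 4; 5; 0;
       6; 4; 0; 7; 5; 4; 0; 6; 4; 5; 1; 3; 5; 4; 6; 0; 4; 7; 5; 0; 4; 6; 0; 5; 2; 6;
       0; 4; 6; 5; 0; 7; 5]);
  ([:: false; true; true; true; true; true; false; false],
   [:: 6; 5; 0; 7; 5; 4; 2; 3; 4; 5; 7; 0; 5; 6; 4; 0; 5; 7; 0; 4; 1; 7; 0; 5; 7; 4;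
       0; 6; 7; 5; 0; 7; 2; 6; 7; 5; 0; 4; 6; 0; 1; 4; 5; 0; 6; 4; 0; 7; 5; 4; 0; 6;
       4; 5; 1; 3; 5; 4; 6; 0; 4; 5; 7; 0; 4; 6; 0; 5; 2; 6; 5; 7; 0; 6; 1; 7; 6; 4;
       0; 5; 7; 0; 1; 7; 6; 5; 0; 7; 5]);
  ([:: true; true; true; true; false; false; true; true],
   [:: 6; 0; 4; 5; 2; 0; 7; 5; 0; 4; 6; 7; 5; 0; 3; 4; 5; 7; 0; 5; 6; 4; 0; 5; 7; 0;
       4; 1; 7; 0; 5; 7; 4; 0; 6; 7; 5; 0; 7; 2; 6; 7; 5; 0; 4; 6; 0; 1; 4; 5; 0; 6;
       4; 0; 7; 5; 4; 0; 6; 4; 5; 1; 3; 5; 4; 6; 0; 4; 5; 7; 0; 4; 6; 0; 5; 2; 6; 0;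
       4; 6; 5; 0; 7; 5]);
  ([:: true; false; false; false; true; true; true; false],
   [:: 6; 7; 4; 0; 6; 2; 3; 6; 0; 4; 7; 5; 0; 4; 6; 0; 5; 3; 6; 0; 4; 6; 5; 7; 1; 4;
       7; 6; 4; 0; 7; 1; 4; 6; 2; 7; 0; 6; 4; 7; 1; 4; 0; 7; 5; 0; 6; 4; 5; 0; 7; 5;
       4; 3; 2; 4; 5; 7; 0; 5; 4; 6; 0; 5; 7; 0; 4; 5; 2; 0; 5; 7; 0; 4; 6; 7; 1; 6;
       0; 7; 5; 0; 4; 6; 5; 0; 7; 5])] s.

Definition route (s : nat) : seq bitseq :=
  let (x, c) := route_code s in x :: scanl (fun y i => flip i y) x c.

(* Odd layers use the path of the twin type, so that adjacent layers whose types are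
   twins carry a path and its own image under [sigma], which are disjoint. *)
Definition twin (s : nat) : nat :=
  if s < 8 then (if odd s then s.-1 else s.+1)
  else if s < 11 then s + 3 else s - 3.

(** Routes start at the shared vertex, so reversal makes an odd layer end there; [sigma] maps the
    start of the route of the twin to the start of the route of [s]. *)
Definition piece (p : bool) (s : nat) : seq bitseq :=
  if p then rev (map sigma (route (twin s))) else route s.

Definition shared (s : nat) : bitseq := head [::] (route s).

Definition outlet (p : bool) (s : nat) : bitseq :=
  if p then head [::] (piece p s) else last [::] (piece p s).

Definition piece_check (p : bool) (s : nat) : bool :=
  if piece p s is x :: t then
    [&& size x == 8, 0 < size t, ipathb x Empty t &
        (if p then last x t else x) == shared s]
  else false.

Lemma pieces_check p s : s < 14 -> piece_check p s.
Proof.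
have : all (fun s => piece_check false s && piece_check true s) (iota 0 14).
  by vm_compute.
move/allP=> h s14; have := h s; rewrite mem_iota => /(_ s14)/andP[].
by case: p.
Qed.

Lemma piece_size p s : s < 14 -> {in piece p s, forall x, size x = 8}.
Proof.
move=> /(pieces_check p); rewrite /piece_check.
case: (piece p s) => // x t /and4P[/eqP sz_x _ /ipathbP[_ sz_t] _] y.
by rewrite inE -sz_x => /predU1P[->|/sz_t].
Qed.

Lemma piece_ipath p s : s < 14 -> ipath (piece p s).
Proof.
move=> /(pieces_check p); rewrite /piece_check.
by case: (piece p s) => // x t /and4P[_ _ /ipathbP[]].
Qed.

Lemma piece_ends p s : s < 14 -> exists r,
  piece p s = if p then outlet p s :: rcons r (shared s)
              else shared s :: rcons r (outlet p s).
Proof.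
move=> /(pieces_check p); rewrite /piece_check /outlet.
case: (piece p s) => // x t /and4P[_ + _ /eqP <-].
case/lastP: t => // r y _; exists r.
by case: p; rewrite /= last_rcons.
Qed.

(** The decidable form of the intersection hypothesis on the pieces, for [l = 3]. *)
Definition meet_check (s t : nat) : bool :=
  let T := trie_of (piece true t) in
  all (fun x => trie_mem x T ==>
    (if s == t then x == shared s
     else if joint 3 s t then x == outlet false s else ~~ clash 4 s t)) (piece false s).

Lemma joints_meets_check s t : s < 14 -> t < 14 ->
  (joint 3 s t ==> (outlet false s == outlet true t)) && meet_check s t.
Proof.
have : all (fun s => all (fun t => (joint 3 s t ==> (outlet false s == outlet true t))
    && meet_check s t) (iota 0 14)) (iota 0 14) by vm_compute.
move/allP=> h s14 t14; have := h s; rewrite mem_iota => /(_ s14)/allP/(_ t).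
by rewrite mem_iota => /(_ t14).
Qed.

Lemma piece_joint s t : s < 14 -> t < 14 -> joint 3 s t ->
  outlet false s = outlet true t.
Proof. by move=> s14 t14 st; have := joints_meets_check s14 t14; rewrite st => /andP[/eqP]. Qed.

Lemma piece_meet s t x : s < 14 -> t < 14 ->
  x \in piece false s -> x \in piece true t ->
  if s == t then x = shared s
  else if joint 3 s t then x = outlet false s else ~~ clash 4 s t.
Proof.
move=> s14 t14 xs xt; have /andP[_ /allP/(_ x xs)] := joints_meets_check s14 t14.
rewrite (trie_of_mem (piece_size t14) xt) /=.
by case: (s == t) => [/eqP|] //; case: (joint 3 s t) => [/eqP|].
Qed.

(** * Weights of the types and the resulting bound *)

Definition level_weight (i : nat) : nat := nth 0 [:: 181; 181; 189; 177] i.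

(** By the choice of [twin] both types of a level give the same total. *)
Lemma level_weightP i (a : bool) : i < 4 ->
  level_weight i <= size (piece false (i.*2 + a)) + size (piece true (i.*2 + a)).
Proof.
by case: i => [|[|[|[|i]]]] //; case: a => _; vm_compute.
Qed.

(** Summing over the 16 extensions by four leading coordinates averages out the colours: more than
    88 vertices per layer, whatever the initial parity and colours. *)
Lemma deep_weightP p c d : c < 6 -> d < 6 ->
  1415 <= iter 4 extend (fun q e _ => size (piece q (8 + e))) p c d.
Proof.
have : all (fun c => all (fun d => all (fun p =>
    1415 <= iter 4 extend (fun q e _ => size (piece q (8 + e))) p c d)
    [:: false; true]) (iota 0 6)) (iota 0 6) by vm_compute.
move/allP=> h c6 d6; have := h c; rewrite mem_iota => /(_ c6)/allP/(_ d).
by rewrite mem_iota => /(_ d6)/allP/(_ p); apply; case: p.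
Qed.

Lemma snake_lower_bound e :
  (181 * 2 ^ 6 + 181 * 2 ^ 5 + 189 * 2 ^ 4 + 177 * 2 ^ 3 + 1415) * 2 ^ (e + 5) <=
  (max_snake_length (e + 21)).+1.
Proof.
(* Eight of the [e + 21] coordinates belong to the pieces, and the Gray code runs over the other 13
   + e. *)
pose s := family_path 3 piece (e + 13).
have s_size : {in s, forall x, size x = e + 21}.
  move=> x /(@family_path_size 8 3 piece piece_size)->; lia.
have s_ipath : ipath s.
  apply: (@family_path_ipath 8 3 outlet shared piece piece_size piece_ipath piece_ends
    piece_joint piece_meet); lia.
apply: leq_trans (_ : size s <= _); last first.
  by have := ipath_max_snake_length s_size s_ipath; case: (size s).
have -> : size s = \sum_(u <- gray (e + 8 + 4).+1) size (piece (parity u) (0 + mtype 4 u)).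
  rewrite /s /family_path size_flatten /shape sumnE !big_map.
  have -> : (e + 8 + 4).+1 = e + 13 by lia.
  by apply: eq_bigr => u _; rewrite size_map.
apply: leq_trans (sum_levels (len := fun p s => size (piece p s)) (w := level_weight) _ _).
  (* Beyond the four levels suffixes of length [e + 9] remain, taken in blocks of 16 by their four
     leading coordinates. *)
  have := @sum_colours_ge (fun q e _ => size (piece q (8 + e))) (e + 5) 4 1415 deep_weightP.
  have -> : e + 5 + 4 = (e + 8).+1 by lia.
  move=> h; apply: leq_trans (leq_add (leqnn _) h).
  rewrite !big_ord_recl big_ord0 /level_weight /= /bump /=.
  have -> : e + 8 + 4 - 1 = e + 5 + 6 by lia.
  have -> : e + 8 + 4 - 2 = e + 5 + 5 by lia.
  have -> : e + 8 + 4 - 3 = e + 5 + 4 by lia.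
  have -> : e + 8 + 4 - 4 = e + 5 + 3 by lia.
  rewrite !(expnD 2 (e + 5)); move: (2 ^ (e + 5)) => x; lia.
by move=> i a i4; apply: level_weightP.
Qed.

Import Order.TTheory GRing.Theory Num.Theory.
Local Open Scope ring_scope.

Theorem theorem1 (d : nat) (hd : (21 <= d)%N) :
  let c : int :=
    Num.ceil (928503%:R / 2621440%:R * 2 ^+ d + 683 / 5 : rat) in
  (c <= (max_snake_length d)%:Z) /\ (17 / 48 * 2 ^+ d <= c%:~R :> rat).
Proof.
move=> c; rewrite -(subnK hd) in c *; set e := (d - 21)%N in c *.
have pow : 2 ^+ (e + 21) = 2 ^+ e * 2 ^+ 21 :> rat by rewrite exprD.
have pow_ge1 : 1 <= 2 ^+ e :> rat by rewrite exprn_ege1.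
have := snake_lower_bound e; rewrite -(ler_nat rat) -natr1 expnD !(natrM, natrD, natrX).
rewrite /c pow => size_ge; split.
  rewrite ceil_le_int -pmulrn; move: pow_ge1 size_ge.
  (* The count of vertices exceeds the main term by [589.6 * 2 ^+ e], which covers both [683 / 5]
     and the loss of 1 from vertices to edges. *)
  by move: (2 ^+ e) (max_snake_length _)%:R => x y; lra.
apply: le_trans (ceil_ge _); move: pow_ge1; move: (2 ^+ e) => x; lra.
Qed.
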